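(* Let $\Omega=\{1,\dots,d\}^{\mathbb N}$ with the shift $\sigma$, let $A:\Omega\to\mathbb R$ be Lipschitz continuous, let $h$ be the Peierls barrier of $A$ and $\mathcal A$ the Aubry set of $A$. Let $x,y,z\in\mathcal A$. If $h(x,y)+h(y,x)=0$ and $h(y,z)+h(z,y)=0$, then $h(x,z)+h(z,x)=0$.
   Context: $\Omega$ carries the metric $d(x,y)=2^{-\min\{n:\ x_n\ne y_n\}}$ and $\sigma(x_0x_1x_2\ldots)=x_1x_2\ldots$. $m(A)=\max\int A\,d\nu$ over $\sigma$-invariant Borel probability measures $\nu$. $S_n(f)=f+f\circ\sigma+\dots+f\circ\sigma^{n-1}$. The Peierls barrier is $$h(x,y)=\lim_{\epsilon\to0}\ \limsup_{n\to\infty}\ \sup\{S_n(A-m(A))(z):\ z\in\Omega,\ \sigma^n(z)=y,\ d(x,z)<\epsilon\}\in[-\infty,+\infty).$$ The Mañé potential is $S_A(x,y)=\lim_{\epsilon\to0}\sup\{S_n(A-m(A))(z):\ n\ge1,\ \sigma^n(z)=y,\ d(z,x)<\epsilon\}$, and the Aubry set is $\mathcal A=\{x\in\Omega:\ S_A(x,x)=0\}$. *)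

(* Defs.v *)
From HB Require Import structures.
From mathcomp Require Import all_boot all_order all_algebra.
From mathcomp Require Import all_classical all_reals all_analysis.

Set Implicit Arguments.
Unset Strict Implicit.
Unset Printing Implicit Defensive.

Import Order.TTheory GRing.Theory Num.Theory.
Import numFieldNormedType.Exports.

Local Open Scope classical_set_scope.
Local Open Scope ring_scope.

(* The full shift space on [d.+1] symbols (a nonempty alphabet, so that the
   space is pointed). The parameter [R] is only the field in which the metric
   takes its values. *)
Definition Omega (R : realType) (d : nat) : Type := nat -> 'I_d.+1.

Section Metric.
Variables (R : realType) (d : nat).
Implicit Types x y z : Omega R d.

HB.instance Definition _ := gen_eqMixin (Omega R d).
HB.instance Definition _ := gen_choiceMixin (Omega R d).
HB.instance Definition _ := isPointed.Build (Omega R d) (fun=> ord0).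

Definition Omega_dist x y : R :=
  if pselect (exists n, x n != y n) is left xy then 2 ^- ex_minn xy else 0.

Lemma Omega_dist_le x y n :
  (forall i, (i < n)%N -> x i = y i) <-> Omega_dist x y <= 2 ^- n.
Proof.
rewrite /Omega_dist; case: pselect => [xy|nxy].
  case: ex_minnP => m xym mmin; split=> [eqxy|].
    rewrite lef_pV2 ?posrE ?exprn_gt0// ler_eXn2l ?ltr1n// leqNgt.
    by apply/negP => /eqxy xyE; rewrite xyE eqxx in xym.
  rewrite lef_pV2 ?posrE ?exprn_gt0// ler_eXn2l ?ltr1n// => nm i ni.
  apply/eqP; apply: contraT => /mmin mi.
  by have := leq_trans ni (leq_trans nm mi); rewrite ltnn.
split=> [_|_ i _]; first by rewrite invr_ge0 exprn_ge0.
by apply/eqP; apply: contraT => xyi; exfalso; apply: nxy; exists i.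
Qed.

Lemma Omega_dist_ge0 x y : 0 <= Omega_dist x y.
Proof.
by rewrite /Omega_dist; case: pselect => // xy; rewrite invr_ge0 exprn_ge0.
Qed.

Lemma Omega_distxx x : Omega_dist x x = 0.
Proof.
rewrite /Omega_dist; case: pselect => // xx.
by exfalso; case: xx => n; rewrite eqxx.
Qed.

Lemma Omega_dist_eq0 x y : Omega_dist x y = 0 -> x = y.
Proof.
move=> xy0; apply/funext => i.
have /Omega_dist_le : Omega_dist x y <= 2 ^- i.+1.
  by rewrite xy0 invr_ge0 exprn_ge0.
exact.
Qed.

Lemma Omega_dist_sym x y : Omega_dist x y = Omega_dist y x.
Proof.
suff le : forall u v, Omega_dist u v <= Omega_dist v u.
  by apply/le_anti; rewrite !le.
move=> u v; rewrite [X in _ <= X]/Omega_dist; case: pselect => [vu|nvu].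
  apply/Omega_dist_le; case: ex_minnP => m _ mmin i im; apply/eqP.
  by apply: contraT; rewrite eq_sym => /mmin; rewrite leqNgt im.
rewrite (_ : u = v) ?Omega_distxx//; apply/funext => i; apply/eqP.
by apply: contraT => uvi; exfalso; apply: nvu; exists i; rewrite eq_sym.
Qed.

Lemma Omega_dist_triangle y x z :
  Omega_dist x z <= Omega_dist x y + Omega_dist y z.
Proof.
rewrite [X in X <= _]/Omega_dist; case: pselect => [xz|_]; last first.
  by rewrite addr_ge0 ?Omega_dist_ge0.
case: ex_minnP => m xzm _; have [xym|xym] := eqVneq (x m) (y m).
  apply: ler_wpDl; first exact: Omega_dist_ge0.
  rewrite leNgt; apply/negP => lt_m; move: xzm; rewrite xym => /negP; apply.
  move: lt_m; rewrite /Omega_dist; case: pselect => [yz|nyz _].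
    case: ex_minnP => k _ kmin.
    rewrite ltf_pV2 ?posrE ?exprn_gt0// ltr_eXn2l ?ltr1n// => mk.
    by apply: contraT => /kmin; rewrite leqNgt mk.
  by apply: contraT => yzm; exfalso; apply: nyz; exists m.
apply: ler_wpDr; first exact: Omega_dist_ge0.
rewrite /Omega_dist; case: pselect => [xy|nxy]; last by case: nxy; exists m.
case: ex_minnP => k _ /(_ _ xym) km.
by rewrite lef_pV2 ?posrE ?exprn_gt0// ler_eXn2l ?ltr1n.
Qed.

HB.instance Definition _ := isMetric.Build R (Omega R d)
  Omega_distxx Omega_dist_eq0 Omega_dist_sym Omega_dist_triangle.

End Metric.

Section Barrier.
Variables (R : realType) (d : nat).
Local Notation Omega := (Omega R d).

Definition shift_map (x : Omega) : Omega := fun n => x n.+1.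

Definition lipschitz_fun (A : Omega -> R) : Prop :=
  exists k : R, forall x y : Omega, `|A x - A y| <= k * mdist x y.

Definition borelOmega := g_sigma_algebraType (@open Omega).

Definition shift_invariant (nu : probability borelOmega R) : Prop :=
  forall B : set borelOmega, measurable B -> nu (shift_map @^-1` B) = nu B.

(* For continuous [A] the supremum is attained, by compactness of the set of
   invariant probability measures, so this is the maximum. *)
Definition maxint (A : Omega -> R) : R :=
  sup [set \int[nu]_w A w | nu in [set nu | shift_invariant nu]].

Definition birkhoff (n : nat) (f : Omega -> R) (z : Omega) : R :=
  \sum_(k < n) f (iter k shift_map z).

Definition normalized (A : Omega -> R) : Omega -> R := fun w => A w - maxint A.

Local Open Scope ereal_scope.

(* [ereal_sup set0 = -oo], the convention needed when no admissible [z] exists.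
   Both suprema below are nondecreasing in [e], so the limits exist. *)
Definition peierls (A : Omega -> R) (x y : Omega) : \bar R :=
  lim (limn_esup (fun n : nat =>
         ereal_sup [set (birkhoff n (normalized A) z)%:E | z in
           [set z : Omega | iter n shift_map z = y /\ (mdist x z < e)%R]])
       @[e --> (0 : R)^'+]).

Definition mane (A : Omega -> R) (x y : Omega) : \bar R :=
  lim (ereal_sup [set u : \bar R | exists (n : nat) (z : Omega),
         [/\ (1 <= n)%N, iter n shift_map z = y, (mdist z x < e)%R &
             u = (birkhoff n (normalized A) z)%:E]]
       @[e --> (0 : R)^'+]).

Definition aubry (A : Omega -> R) : set Omega := [set x | mane A x x = 0].

End Barrier.

(* Main.v *)
Require Import Defs.
From mathcomp Require Import all_boot all_order all_algebra.
From mathcomp Require Import all_classical all_reals all_analysis.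
From mathcomp Require Import ring lra.

(** The barrier is superadditive, [h(x,y) + h(y,z) <= h(x,z)]: glue the first
    [n] symbols of an orbit ending at [y] to an orbit starting near [y]; the
    shift being expanding, the Birkhoff sums change by at most the Lipschitz
    constant times the gap at [y].  Hence [h(x,z) + h(z,x)] is bounded below by
    [h(x,y) + h(y,z) + h(z,y) + h(y,x) = 0], and bounded above by
    [h(x,x) <= S_A(x,x) = 0], as [x] lies in the Aubry set. *)

Import Order.TTheory GRing.Theory Num.Theory.

Local Open Scope classical_set_scope.
Local Open Scope ereal_scope.

(** * Monotone limits, upper limits and sums in the extended reals *)

Section ExtendedReals.
Context {R : realType}.

Lemma lim_at_right0_nondecreasing (f : R -> \bar R) :
    (forall e e', (0 < e)%R -> (e <= e')%R -> f e <= f e') ->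
  lim (f e @[e --> (0 : R)^'+]) = ereal_inf [set f e | e in [set e | (0 < e)%R]].
Proof.
move=> fnd.
have -> : [set e : R | (0 < e)%R] = [set` `]0%R, +oo[%R].
  by apply/seteqP; split=> e /=; rewrite in_itv/= andbT.
apply/cvg_lim => //; apply: nondecreasing_at_right_cvge => //.
by move=> e e'; rewrite in_itv /= andbT => e0 _; exact: fnd.
Qed.

Lemma lt_limn_esup (u : nat -> \bar R) (l : \bar R) N :
  l < limn_esup u -> exists2 n, (N <= n)%N & l < u n.
Proof.
move=> lu; suff /ereal_sup_gt[_ [n /= Nn <-] ln] :
    l < ereal_sup (u @` [set n | (N <= n)%N]) by exists n.
apply: lt_le_trans lu _; apply: ereal_inf_lbound.
by exists [set n | (N <= n)%N] => //; exists N.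
Qed.

Lemma limn_esup_ge (u : nat -> \bar R) (l : \bar R) :
  (forall N, exists2 n, (N <= n)%N & l <= u n) -> l <= limn_esup u.
Proof.
move=> lu; apply: le_ereal_inf_tmp => _ [V [N _ NV] <-].
have [n Nn ln] := lu N; apply: le_trans ln _; apply: ereal_sup_ubound.
by exists n => //; exact: NV.
Qed.

(** This reduces superadditivity to real lower approximations, so that infinite values of the
    barrier are dealt with once and for all. *)
Lemma lee_adde_lt (u v w : \bar R) :
    (forall a b : R, a%:E < u -> b%:E < v -> (a + b)%:E <= w) ->
  u + v <= w.
Proof.
move=> uvw.
have below (t : \bar R) : t != -oo -> exists r : R, r%:E < t.
  case: t => [r| |] // _; last by exists 0%R; rewrite ltry.
  by exists (r - 1)%R; rewrite lte_fin; lra.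
(* In [\bar R], [-oo] absorbs even [+oo], so the sum is [-oo]. *)
have [->|uN] := eqVneq u -oo; first by rewrite addNye leNye.
have [->|vN] := eqVneq v -oo; first by rewrite addeNy leNye.
case: u v uN vN uvw => [r| |] [s| |] // uN vN uvw.
- apply/lee_subgt0Pr => e e0; rewrite -!EFinD.
  have -> : (r + s - e = (r - e / 2) + (s - e / 2))%R by field.
  by apply: uvw; rewrite lte_fin; lra.
(* With [a] fixed below the finite summand, [t - a] is below [+oo] for every real [t], so [w]
   exceeds every real. *)
- have [a ar] := below _ uN; rewrite (@eq_infty _ w) // => t.
  by have := uvw _ (t - a)%R ar (ltry _); rewrite addrC subrK.
- have [a ar] := below _ vN; rewrite (@eq_infty _ w) // => t.
  by have := uvw (t - a)%R _ (ltry _) ar; rewrite subrK.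
- rewrite (@eq_infty _ w) // => t.
  by have := uvw t 0%R (ltry _) (ltry _); rewrite addr0.
Qed.

End ExtendedReals.

(** * Inverse branches of the shift and shadowing of orbits *)

Section ShiftSpace.
Context {R : realType} {d : nat}.
Local Notation Om := (Omega R d).
Implicit Types (A : Om -> R) (x y z w : Om).

(** The inverse branches of the shift; they contract by a factor 2. *)
Definition prepend (a : 'I_d.+1) (w : Om) : Om :=
  fun n => if n is k.+1 then w k else a.

Lemma mdist_prepend (a : 'I_d.+1) v w :
  (mdist (prepend a v : Om) (prepend a w) <= mdist v w / 2)%R.
Proof.
change (Omega_dist (prepend a v : Om) (prepend a w) <= Omega_dist v w / 2)%R.
have [<-|vw] := pselect (v = w); first by rewrite !Omega_distxx mul0r.
rewrite [in leRHS]/Omega_dist; case: pselect => [e|nvw]; last first.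
  exfalso; apply: vw; apply/funext => i; apply/eqP; apply: contraT => vwi.
  by exfalso; apply: nvw; exists i.
case: ex_minnP => m _ mmin; rewrite -invfM -exprSr.
apply/Omega_dist_le => -[|i] //= im; apply/eqP; apply: contraT => /mmin.
by rewrite leqNgt -ltnS im.
Qed.

Lemma prepend_head_shift w : prepend (w 0%N) (shift_map w) = w.
Proof. by apply/funext => -[]. Qed.

Lemma birkhoffD n m (f : Om -> R) w :
  birkhoff (n + m) f w = (birkhoff n f w + birkhoff m f (iter n (@shift_map R d) w))%R.
Proof.
rewrite /birkhoff big_split_ord /=; congr (_ + _)%R.
by apply: eq_bigr => i _; rewrite addnC iterD.
Qed.

Lemma birkhoffS n (f : Om -> R) w :
  birkhoff n.+1 f w = (f w + birkhoff n f (shift_map w))%R.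
Proof. by rewrite -add1n birkhoffD /birkhoff big_ord1. Qed.

Lemma lipschitz_normalized A : lipschitz_fun A ->
  exists2 K : R, (0 <= K)%R & forall v w,
    (`|normalized A v - normalized A w| <= K * mdist v w)%R.
Proof.
move=> [k Ak]; exists `|k|%R => // v w.
have -> : (normalized A v - normalized A w = A v - A w)%R.
  by rewrite /normalized; ring.
apply: le_trans (Ak v w) _; rewrite ler_wpM2r ?ler_norm //.
exact: (@Omega_dist_ge0 R d).
Qed.

(* Bounding the error by [K (D - mdist v w)] rather than [K D] makes the
   geometric series telescope along the induction. *)
Lemma shadowing (f : Om -> R) (K : R) n v (t : Om) :
    (0 <= K)%R -> (forall v w, `|f v - f w| <= K * mdist v w)%R ->
  exists w, [/\ iter n (@shift_map R d) w = t,
    (mdist v w <= mdist (iter n (@shift_map R d) v) t)%R &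
    (`|birkhoff n f v - birkhoff n f w| <=
      K * (mdist (iter n (@shift_map R d) v) t - mdist v w))%R].
Proof.
move=> K0 fK; elim: n v => [|n IHn] v.
  exists t; split=> //=.
  by rewrite /birkhoff !big_ord0 subrr normr0 subrr mulr0.
have [w [wt vw Sw]] := IHn (shift_map v).
have half : (mdist v (prepend (v 0%N) w) <= mdist (shift_map v) w / 2)%R.
  by rewrite -[v in X in (X <= _)%R]prepend_head_shift mdist_prepend.
have shw : shift_map (prepend (v 0%N) w) = w by [].
have d0 : (0 <= mdist (shift_map v) w)%R by exact: (@Omega_dist_ge0 R d).
exists (prepend (v 0%N) w); rewrite !iterSr shw; split=> //.
  by apply: le_trans vw; apply: le_trans half _; lra.
rewrite !birkhoffS shw; set p := prepend _ _ in half *.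
have -> : forall a b c e : R, (a + b - (c + e) = (a - c) + (b - e))%R.
  by move=> *; ring.
apply: le_trans (ler_normD _ _) _; apply: le_trans (lerD (fK _ _) Sw) _.
(* What remains is that twice the distance from [v] to [p] is at most that from [shift_map v] to
   [w], which is [half]. *)
by rewrite -mulrDr ler_wpM2l //; lra.
Qed.

(** * The Peierls barrier and its comparison with the Mañé potential *)

Definition orbit_sup A x y (e : R) (n : nat) : \bar R :=
  ereal_sup [set (birkhoff n (normalized A) z)%:E | z in
    [set z : Om | iter n (@shift_map R d) z = y /\ (mdist x z < e)%R]].

Lemma peierlsE A x y : peierls A x y =
  ereal_inf [set limn_esup (orbit_sup A x y e) | e in [set e : R | (0 < e)%R]].
Proof.
apply: lim_at_right0_nondecreasing => e e' _ ee'.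
apply: le_ereal_inf_tmp => _ [V oV <-].
apply: ge_ereal_inf; exists (ereal_sup (orbit_sup A x y e @` V)); first by exists V.
apply: ge_ereal_sup => _ [n Vn <-].
apply: ge_ereal_sup => _ [w [wy xw] <-].
apply: (@le_trans _ _ (orbit_sup A x y e' n)).
  by apply: ereal_sup_ubound; exists w => //; split=> //; exact: lt_le_trans ee'.
by apply: ereal_sup_ubound; exists n.
Qed.

(** The barrier is an infimum over [e], and each upper limit is at most the supremum of any tail, so
    [e] and [N] can be prescribed. *)
Lemma lt_peierls A x y (l : \bar R) (e : R) N : l < peierls A x y -> (0 < e)%R ->
  exists n w, [/\ (N <= n)%N, iter n (@shift_map R d) w = y, (mdist x w < e)%R &
    l < (birkhoff n (normalized A) w)%:E].
Proof.
rewrite peierlsE => lh e0.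
have /(lt_limn_esup _ _ N)[n Nn] : l < limn_esup (orbit_sup A x y e).
  by apply: lt_le_trans lh _; apply: ereal_inf_lbound; exists e.
by move=> /ereal_sup_gt[_ [w [wy xw] <-]] lw; exists n, w.
Qed.

Lemma peierls_ge A x y (c : R) :
    (forall e N, (0 < e)%R -> exists n w,
      [/\ (N <= n)%N, iter n (@shift_map R d) w = y, (mdist x w < e)%R &
          (c <= birkhoff n (normalized A) w)%R]) ->
  c%:E <= peierls A x y.
Proof.
move=> hc; rewrite peierlsE; apply: le_ereal_inf_tmp => _ [e /= e0 <-].
apply: limn_esup_ge => N; have [n [w [Nn wy xw cw]]] := hc e N e0.
exists n => //; apply: (@le_trans _ _ (birkhoff n (normalized A) w)%:E).
  by rewrite lee_fin.
by apply: ereal_sup_ubound; exists w.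
Qed.

Lemma peierls_superadditive A x y z : lipschitz_fun A ->
  peierls A x y + peierls A y z <= peierls A x z.
Proof.
move=> /lipschitz_normalized[K K0 AK]; apply: lee_adde_lt => a b ah bh.
apply/lee_subgt0Pr => c c0; rewrite -EFinB; apply: peierls_ge => e N e0.
have e20 : (0 < e / 2)%R by lra.
have [n [v [Nn vy xv av]]] := lt_peierls _ _ _ _ _ N ah e20.
have K1 : (0 < K + 1)%R by lra.
(* The gap at [y] must keep the glued point within [e] of [x] and cost at most [c] in the Birkhoff
   sum; [K + 1] avoids dividing by zero. *)
have r0 : (0 < Num.min (e / 2) (c / (K + 1)))%R by rewrite lt_min e20 divr_gt0.
have [m [t [_ tz yt bt]]] := lt_peierls _ _ _ _ _ 0%N bh r0; rewrite !lte_fin in av bt.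
move: yt; rewrite lt_min => /andP[yte ytc].
(* The tail [y] of [v] after [n] symbols is replaced by [t], whose orbit then reaches [z]. *)
have [w [wt vw Sw]] := shadowing _ _ n v t K0 AK.
rewrite vy in vw Sw.
exists (n + m)%N, w; split.
- exact: leq_trans (leq_addr _ _).
- by rewrite addnC iterD wt.
- apply: le_lt_trans (@Omega_dist_triangle R d v x w) _.
  by move: xv vw yte; rewrite /mdist /=; lra.
- rewrite birkhoffD wt.
  have d0 : (0 <= mdist v w)%R by exact: (@Omega_dist_ge0 R d).
  have D0 : (0 <= mdist y t)%R by exact: (@Omega_dist_ge0 R d).
  have Kc : (mdist y t * (K + 1) <= c)%R by rewrite -ler_pdivlMr // ltW.
  have := ler_norm (birkhoff n (normalized A) v - birkhoff n (normalized A) w)%R.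
  by nra.
Qed.

Lemma maneE A x y : mane A x y = ereal_inf
  [set ereal_sup [set u : \bar R | exists (n : nat) (z : Om),
     [/\ (1 <= n)%N, iter n (@shift_map R d) z = y, (mdist z x < e)%R &
         u = (birkhoff n (normalized A) z)%:E]]
   | e in [set e : R | (0 < e)%R]].
Proof.
apply: lim_at_right0_nondecreasing => e e' _ ee'.
apply: ereal_sup_le => _ [n [w [n1 wy wx ->]]]; exists n, w; split=> //.
exact: lt_le_trans ee'.
Qed.

Lemma peierls_le_mane A x y : peierls A x y <= mane A x y.
Proof.
rewrite maneE; apply: le_ereal_inf_tmp => _ [e /= e0 <-].
rewrite leNgt; apply/negP; set s := ereal_sup _ => sh.
(* The bound [1] on the length is what [mane] demands; the orbit found would beat the supremum
   [s]. *)
have [n [w [n1 wy xw]]] := lt_peierls _ _ _ _ _ 1 sh e0.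
rewrite ltNge => /negP; apply; apply: ereal_sup_ubound; exists n, w; split=> //.
by move: xw; rewrite /mdist /= Omega_dist_sym.
Qed.

End ShiftSpace.

Theorem lemma4p4 (R : realType) (d : nat) (A : Omega R d -> R)
    (hA : lipschitz_fun A) (x y z : Omega R d)
    (hx : aubry A x) (hy : aubry A y) (hz : aubry A z)
    (hxy : peierls A x y + peierls A y x = 0)
    (hyz : peierls A y z + peierls A z y = 0) :
  peierls A x z + peierls A z x = 0.
Proof.
apply/eqP; rewrite eq_le; apply/andP; split.
  by rewrite -[X in _ <= X]hx (le_trans (peierls_superadditive _ _ _ _ hA)) ?peierls_le_mane.
(* The zero sum for [y] and [z] is inserted between the two terms of the one for [x] and [y], then
   regrouped into paths from [x] to [z] and back. *)
rewrite -hxy -[peierls A y x]add0e -hyz addeA addeA -addeA.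
by apply: leeD; exact: peierls_superadditive.
Qed.
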